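(* Let $0\to L\xrightarrow{v} M\xrightarrow{w} N\to 0$ be an exact sequence of finitely generated $R$-modules. Then the sequence $0\to L_\alpha\xrightarrow{v_\alpha} M_\alpha\xrightarrow{w_\alpha} N_\alpha\to 0$ is exact for almost all $\alpha$.
   Context: Let $k$ be an arbitrary infinite field, $u=(u_1,\ldots,u_m)$ and $x=(x_1,\ldots,x_n)$ indeterminates, and $R=k(u)[x]$. Let $K$ be an extension field of $k$; for $\alpha\in K^m$ put $R_\alpha=k(\alpha)[x]$. A property holds for almost all $\alpha$ if it holds for all $\alpha\in K^m$ except perhaps those lying on a proper algebraic subvariety of $K^m$ (which may depend on the given data). Every $a\in R$ can be written $a(u,x)=p(u,x)/q(u)$ with $p\in k[u,x]$, $q\in k[u]\setminus\{0\}$; for $\alpha$ with $q(\alpha)\neq 0$ put $a(\alpha,x)=p(\alpha,x)/q(\alpha)\in R_\alpha$. For a matrix $A=(a_{ij}(u,x))$ over $R$ put $A_\alpha=(a_{ij}(\alpha,x))$; this is defined for almost all $\alpha$. The specialization $F_\alpha$ of a free $R$-module $F$ of finite rank is a free $R_\alpha$-module of the same rank. With bases fixed, the specialization $\phi_\alpha:F_\alpha\to G_\alpha$ of a homomorphism $\phi:F\to G$ of free $R$-modules of finite ranks with matrix $A$ is the homomorphism with matrix $A_\alpha$. Each finitely generated $R$-module $L$ is considered together with a fixed (arbitrary) finite free presentation $F_1\xrightarrow{\phi}F_0\to L\to 0$ (free modules of finite ranks), and its specialization is $L_\alpha:=\operatorname{Coker}\phi_\alpha$. For a homomorphism $v:L\to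 M$, with presentations $F_1\xrightarrow{\phi}F_0\to L\to0$ and $G_1\xrightarrow{\psi}G_0\to M\to0$, choose lifts $v_0:F_0\to G_0$, $v_1:F_1\to G_1$ making the diagram of presentations commute. For almost all $\alpha$ one has $(v_0)_\alpha\phi_\alpha=\psi_\alpha(v_1)_\alpha$, and the specialization $v_\alpha:L_\alpha\to M_\alpha$ is the homomorphism induced by $(v_0)_\alpha$ on cokernels. *)

(* Defs.v *)
From HB Require Import structures.
From mathcomp Require Export all_boot all_order all_algebra.
From mathcomp Require Export boolp classical_sets cardinality.
From mathcomp Require Export mpoly.

Set Implicit Arguments.
Unset Strict Implicit.
Unset Printing Implicit Defensive.

Import GRing.Theory.
Local Open Scope ring_scope.
Local Open Scope quotient_scope.
Local Open Scope classical_set_scope.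

Section ZariskiGeneric.
Variables (K : fieldType) (m : nat).

Definition zero_locus (I : set {mpoly K[m]}) : set ('I_m -> K) :=
  [set alpha | forall f, I f -> f.@[alpha] = 0].

Definition almost_all (P : ('I_m -> K) -> Prop) : Prop :=
  exists I : set {mpoly K[m]},
    zero_locus I <> [set: 'I_m -> K] /\
    forall alpha, ~ zero_locus I alpha -> P alpha.

End ZariskiGeneric.

Definition short_exact (S : pzRingType) (L M N : lmodType S)
    (v : {linear L -> M}) (w : {linear M -> N}) : Prop :=
  [/\ forall x, v x = 0 -> x = 0,
      forall y, w y = 0 <-> exists x, v x = y
    & forall z, exists y, w y = z].

(* The cokernel of the homomorphism z |-> A *m z from S^q to S^p. *)
Section Cokernel.
Variables (S : comNzRingType) (p q : nat) (A : 'M[S]_(p, q)).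

Definition im_mx : {pred 'cV[S]_p} := [pred z | `[< exists y, z = A *m y >]].

Lemma im_mxP z : reflect (exists y, z = A *m y) (z \in im_mx).
Proof. exact: asboolP. Qed.

Fact im_mx_zmod_closed : zmod_closed im_mx.
Proof.
split=> [|_ _ /im_mxP[y1 ->] /im_mxP[y2 ->]]; apply/im_mxP.
  by exists 0; rewrite mulmx0.
by exists (y1 - y2); rewrite mulmxBr.
Qed.
HB.instance Definition _ :=
  GRing.isZmodClosed.Build 'cV[S]_p im_mx im_mx_zmod_closed.

Definition coker := Quotient.quot im_mx.
HB.instance Definition _ := GRing.Zmodule.on coker.

Definition to_coker (z : 'cV[S]_p) : coker := \pi_(Quotient.quot im_mx) z.
Definition coker_repr (x : coker) : 'cV[S]_p := repr x.

Lemma coker_reprK x : to_coker (coker_repr x) = x.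
Proof. exact: reprK. Qed.

Lemma to_coker_eq y z : to_coker y = to_coker z <-> exists t, y - z = A *m t.
Proof.
split=> [/eqP e | e].
  by apply/im_mxP; rewrite (Quotient.idealrBE im_mx).
by apply/eqP; rewrite /to_coker -(Quotient.idealrBE im_mx); apply/im_mxP.
Qed.

Lemma to_cokerD y z : to_coker (y + z) = to_coker y + to_coker z.
Proof. exact: (raddfD \pi_(Quotient.quot im_mx)). Qed.

Definition coker_scale (a : S) (x : coker) := to_coker (a *: coker_repr x).

Lemma coker_scale_pi a z : coker_scale a (to_coker z) = to_coker (a *: z).
Proof.
apply/to_coker_eq; rewrite -scalerBr.
have /to_coker_eq[t ->] := coker_reprK (to_coker z).
by exists (a *: t); rewrite -scalemxAr.
Qed.

Fact coker_scaleA a b x :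
  coker_scale a (coker_scale b x) = coker_scale (a * b) x.
Proof. by rewrite -[x]coker_reprK !coker_scale_pi scalerA. Qed.

Fact coker_scale1 : left_id 1 coker_scale.
Proof. by move=> x; rewrite -[x]coker_reprK coker_scale_pi scale1r. Qed.

Fact coker_scaleDr : right_distributive coker_scale +%R.
Proof.
move=> a x y; rewrite -[x]coker_reprK -[y]coker_reprK -to_cokerD.
by rewrite !coker_scale_pi scalerDr to_cokerD.
Qed.

Fact coker_scaleDl x : {morph coker_scale^~ x : a b / a + b}.
Proof.
by move=> a b; rewrite -[x]coker_reprK !coker_scale_pi scalerDl to_cokerD.
Qed.

HB.instance Definition _ := GRing.Zmodule_isLmodule.Build S coker
  coker_scaleA coker_scale1 coker_scaleDr coker_scaleDl.

Fact to_coker_is_linear : linear to_coker.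
Proof. by move=> a y z; rewrite to_cokerD -coker_scale_pi. Qed.
HB.instance Definition _ :=
  GRing.isLinear.Build S 'cV[S]_p coker _ to_coker to_coker_is_linear.

End Cokernel.

Section CokernelMap.
Variables (S : comNzRingType) (p0 p1 q0 q1 : nat).
Variables (A : 'M[S]_(p0, p1)) (B : 'M[S]_(q0, q1)).
Variables (V0 : 'M[S]_(q0, p0)) (V1 : 'M[S]_(q1, p1)).

(* The proof argument only ensures that the map does not depend on the choice
   of representatives. *)
Definition coker_map (_ : V0 *m A = B *m V1) (x : coker A) : coker B :=
  to_coker B (V0 *m coker_repr x).

Hypothesis comm : V0 *m A = B *m V1.

Lemma coker_mapE z : coker_map comm (to_coker A z) = to_coker B (V0 *m z).
Proof.
apply/to_coker_eq; rewrite -mulmxBr.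
have /to_coker_eq[t ->] := coker_reprK (to_coker A z).
by exists (V1 *m t); rewrite !mulmxA comm.
Qed.

Fact coker_map_is_linear : linear (coker_map comm).
Proof.
move=> a x y; rewrite -[x]coker_reprK -[y]coker_reprK -linearP.
by rewrite !coker_mapE mulmxDr -scalemxAr linearP.
Qed.
HB.instance Definition _ := GRing.isLinear.Build S (coker A) (coker B) _
  (coker_map comm) coker_map_is_linear.

End CokernelMap.

Section Presentation.
Variable S : comNzRingType.

(* F_1 -> F_0 -> L -> 0 with F_0 and F_1 the modules of column vectors of size
   pres_gens and pres_rels, and F_1 -> F_0 the map y |-> pres_mx *m y. *)
Record presentation (L : lmodType S) := Presentation {
  pres_gens : nat;
  pres_rels : nat;
  pres_mx : 'M[S]_(pres_gens, pres_rels);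
  pres_proj : {linear 'cV[S]_pres_gens -> L};
  pres_surj : forall x, exists z, pres_proj z = x;
  pres_exact : forall z, pres_proj z = 0 <-> exists y, pres_mx *m y = z
}.

Record pres_lift (L M : lmodType S) (PL : presentation L) (PM : presentation M)
    (v : {linear L -> M}) := PresLift {
  lift0 : 'M[S]_(pres_gens PM, pres_gens PL);
  lift1 : 'M[S]_(pres_rels PM, pres_rels PL);
  lift0_comm : forall z, v (pres_proj PL z) = pres_proj PM (lift0 *m z);
  lift1_comm : lift0 *m pres_mx PL = pres_mx PM *m lift1
}.

End Presentation.

(* The subfield k(alpha) of K, where K is an extension of k through iota. *)
Section Adjoin.
Variables (k K : fieldType) (iota : {rmorphism k -> K}).
Variables (m : nat) (alpha : 'I_m -> K).

Definition in_adjoin : {pred K} := [pred z | `[< forall E : {pred K},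
  divring_closed E -> (forall c, iota c \in E) -> (forall i, alpha i \in E) ->
  z \in E >]].

Lemma in_adjoinP z : reflect (forall E : {pred K},
  divring_closed E -> (forall c, iota c \in E) -> (forall i, alpha i \in E) ->
  z \in E) (z \in in_adjoin).
Proof. exact: asboolP. Qed.

Fact in_adjoin_closed : divring_closed in_adjoin.
Proof.
split=> [|x y /in_adjoinP Ex /in_adjoinP Ey|x y /in_adjoinP Ex /in_adjoinP Ey];
  apply/in_adjoinP=> E Ecl Ec Ea; case: (Ecl) => E1 EB EV.
- exact: E1.
- by apply: EB; [apply: Ex | apply: Ey].
- by apply: EV; [apply: Ex | apply: Ey].
Qed.
HB.instance Definition _ :=
  GRing.isDivringClosed.Build K in_adjoin in_adjoin_closed.

Record adjoin := Adjoin { adjoin_val : K; _ : adjoin_val \in in_adjoin }.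

HB.instance Definition _ := [isSub for adjoin_val].
HB.instance Definition _ := [Choice of adjoin by <:].
HB.instance Definition _ := [SubChoice_isSubComUnitRing of adjoin by <:].
HB.instance Definition _ := [SubComUnitRing_isSubIntegralDomain of adjoin by <:].
HB.instance Definition _ := [SubIntegralDomain_isSubField of adjoin by <:].

Fact adjoin_const_subproof c : iota c \in in_adjoin.
Proof. by apply/in_adjoinP=> E _ Ec _; apply: Ec. Qed.
Definition adjoin_const (c : k) : adjoin := Adjoin (adjoin_const_subproof c).

Fact adjoin_gen_subproof i : alpha i \in in_adjoin.
Proof. by apply/in_adjoinP=> E _ _ Ea; apply: Ea. Qed.
Definition adjoin_gen (i : 'I_m) : adjoin := Adjoin (adjoin_gen_subproof i).

Fact adjoin_const_is_zmod_morphism : zmod_morphism adjoin_const.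
Proof. by move=> c d; apply: val_inj; rewrite /= rmorphB. Qed.
Fact adjoin_const_is_monoid_morphism : monoid_morphism adjoin_const.
Proof.
by split=> [|c d]; apply: val_inj; rewrite /= ?rmorph1 ?rmorphM.
Qed.
HB.instance Definition _ := GRing.isZmodMorphism.Build k adjoin adjoin_const
  adjoin_const_is_zmod_morphism.
HB.instance Definition _ := GRing.isMonoidMorphism.Build k adjoin adjoin_const
  adjoin_const_is_monoid_morphism.

End Adjoin.

Lemma fraction_eval_unique (A : idomainType) (F G : fieldType)
    (f : {rmorphism A -> F}) (g : {rmorphism A -> G}) (n : nat)
    (p1 p2 : {mpoly A[n]}) (q1 q2 : A) :
  injective f -> g q1 != 0 -> g q2 != 0 ->
  (f q1)^-1 *: map_mpoly f p1 = (f q2)^-1 *: map_mpoly f p2 ->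
  (g q1)^-1 *: map_mpoly g p1 = (g q2)^-1 *: map_mpoly g p2.
Proof.
move=> f_inj g1 g2 /mpolyP e; apply/mpolyP=> j; move: (e j).
have f0 q : g q != 0 -> f q != 0.
  by apply: contra_neq => fq; rewrite (f_inj q 0) ?rmorph0.
rewrite !mcoeffZ !mcoeff_map_mpoly => ej.
have e2 : q2 * p1@_j = q1 * p2@_j.
  apply: f_inj; rewrite !rmorphM; apply: (mulfI (invr_neq0 (f0 _ g1))).
  by rewrite mulrCA ej mulrA mulfV ?f0 // mul1r mulrA mulVf ?f0 // mul1r.
apply: (mulfI g1); rewrite mulrA mulfV // mul1r.
apply: (mulfI g2); rewrite -rmorphM e2 rmorphM mulrCA (mulrA (g q2)).
by rewrite mulfV // mul1r.
Qed.

(* R = k(u)[x] and R_alpha = k(alpha)[x]. *)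
Notation genpoly k m n := {mpoly {fraction {mpoly k[m]}}[n]}.
Notation specpoly iota alpha n := {mpoly (adjoin iota alpha)[n]}.

Section Specialization.
Variables (k K : fieldType) (iota : {rmorphism k -> K}) (m n : nat).
Variable alpha : 'I_m -> K.

Definition eval_coef (q : {mpoly k[m]}) : adjoin iota alpha :=
  mmap (adjoin_const iota alpha) (adjoin_gen iota alpha) q.

Fact eval_coef_is_zmod_morphism : zmod_morphism eval_coef.
Proof. by move=> p q; rewrite /eval_coef raddfB. Qed.
Fact eval_coef_is_monoid_morphism : monoid_morphism eval_coef.
Proof. by split=> [|p q]; rewrite /eval_coef ?rmorph1 ?rmorphM. Qed.
HB.instance Definition _ := GRing.isZmodMorphism.Build
  {mpoly k[m]} (adjoin iota alpha) eval_coef eval_coef_is_zmod_morphism.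
HB.instance Definition _ := GRing.isMonoidMorphism.Build
  {mpoly k[m]} (adjoin iota alpha) eval_coef eval_coef_is_monoid_morphism.

(* b = a(alpha, x) is computed from some fraction a = p(u, x) / q(u) with
   q(alpha) <> 0; elements of k[u, x] are polynomials in x over k[u]. *)
Definition specializes (a : genpoly k m n) (b : specpoly iota alpha n) : Prop :=
  exists (p : {mpoly {mpoly k[m]}[n]}) (q : {mpoly k[m]}),
    [/\ eval_coef q != 0,
        a = (tofrac q)^-1 *: map_mpoly (@tofrac _) p
      & b = (eval_coef q)^-1 *: map_mpoly eval_coef p].

Lemma specializes_fun a b1 b2 : specializes a b1 -> specializes a b2 -> b1 = b2.
Proof.
move=> [p1 [q1 [hq1 -> ->]]] [p2 [q2 [hq2 e ->]]].
apply: (fraction_eval_unique _ hq1 hq2 e) => x y /eqP.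
by rewrite tofrac_eq => /eqP.
Qed.

Definition specializable (a : genpoly k m n) : Prop :=
  exists b, specializes a b.

(* Meaningful only when a is specializable, 0 otherwise. *)
Definition specialize (a : genpoly k m n) : specpoly iota alpha n :=
  xget 0 [set b | specializes a b].

Definition specializable_mx p q (A : 'M[genpoly k m n]_(p, q)) : Prop :=
  forall i j, specializable (A i j).

Definition spec_mx p q (A : 'M[genpoly k m n]_(p, q)) :
  'M[specpoly iota alpha n]_(p, q) := map_mx specialize A.

Definition spec_mod (L : lmodType (genpoly k m n)) (PL : presentation L) :
  lmodType (specpoly iota alpha n) := coker (spec_mx (pres_mx PL)).

Section SpecMap.
Variables (L M : lmodType (genpoly k m n)).
Variables (PL : presentation L) (PM : presentation M).
Variables (v : {linear L -> M}) (V : pres_lift PL PM v).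

Definition spec_map_defined : Prop :=
  [/\ specializable_mx (pres_mx PL), specializable_mx (pres_mx PM),
      specializable_mx (lift0 V), specializable_mx (lift1 V)
    & spec_mx (lift0 V) *m spec_mx (pres_mx PL) =
      spec_mx (pres_mx PM) *m spec_mx (lift1 V)].

Definition spec_map_comm (d : spec_map_defined) :
    spec_mx (lift0 V) *m spec_mx (pres_mx PL) =
    spec_mx (pres_mx PM) *m spec_mx (lift1 V) :=
  let: And5 _ _ _ _ e := d in e.

Definition spec_map (d : spec_map_defined) :
  {linear spec_mod PL -> spec_mod PM} := coker_map (spec_map_comm d).

End SpecMap.
End Specialization.

(* Main.v *)
From HB Require Import structures.
Require Import Defs.

Set Implicit Arguments.
Unset Strict Implicit.
Unset Printing Implicit Defensive.

Import GRing.Theory Order.TTheory.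
Local Open Scope classical_set_scope.
Local Open Scope ring_scope.

(* Fix alpha, and let O be the local ring of the fractions in k(u) defined at
   alpha and P its maximal ideal, so that O/P = k(alpha).  The image of a matrix
   A over k(u)[x] has a finite Groebner basis (Dickson's lemma), and dividing by
   it only multiplies by the finitely many coefficients of the basis and of its
   expression through the columns of A.  For almost all alpha these coefficients
   lie in O, and then every vector of the image of A with entries in O[x]
   (resp. P[x]) is A t with t over O[x] (resp. P[x]).
   A relation over k(alpha)[x] between specialized matrices lifts to O[x] with
   an error over P[x] lying in an image; the error is absorbed by correcting the
   lift over P[x], so the relation is the specialization of a genuine one, to
   which the exactness over k(u)[x] applies, with a solution over O[x]. *)

(** * Dickson's lemma *)

(* A is the set of coordinates that vary on S.  If s is in S, the elements of S
   not above s lie in the finitely many slices t i = c with i in A and c < s i,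
   on each of which i no longer varies. *)
Lemma dickson_aux n (d : nat) : forall (A : {set 'I_n}) (S : 'X_{1..n} -> Prop),
  #|A| = d ->
  (forall s t i, S s -> S t -> i \notin A -> s i = t i) ->
  exists T : seq 'X_{1..n}, (forall t, t \in T -> S t) /\
    forall s, S s -> exists2 t, t \in T & (t <= s)%MM.
Proof.
elim: d => [|d IH] A S cA eqS.
  case: (pselect (exists s, S s)) => [[s Ss]|nS]; last first.
    by exists [::]; split=> // s Ss; case: nS; exists s.
  exists [:: s]; split=> [t|t St]; first by rewrite inE => /eqP->.
  exists s; rewrite ?inE //; apply/mnm_lepP=> i.
  by rewrite (eqS s t) // (cards0_eq cA) inE.
case: (pselect (exists s, S s)) => [[s Ss]|nS]; last first.
  by exists [::]; split=> // s Ss; case: nS; exists s.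
have slice (ic : 'I_n * nat) : exists T : seq 'X_{1..n},
    (forall t, t \in T -> S t) /\ (ic.1 \in A ->
    forall t, S t -> t ic.1 = ic.2 -> exists2 u, u \in T & (u <= t)%MM).
  case: ic => i c /=; have [iA|niA] := boolP (i \in A); last by exists [::].
  have := IH (A :\ i) (fun t => S t /\ t i = c).
  case=> [|t u j [St ti] [Su ui]|T [T1 T2]].
  - by move: cA; rewrite (cardsD1 i) iA => -[].
  - rewrite !inE negb_and negbK => /predU1P[->|]; first by rewrite ti ui.
    exact: eqS.
  - by exists T; split=> [t /T1[]//|_ t St ti]; apply: T2.
have [T HT] := choice slice.
exists (s :: flatten [seq flatten [seq T (i, c) | c <- iota 0 (s i)]
                     | i <- enum 'I_n]).
split=> [t|t St].
  rewrite inE => /predU1P[->//|/flatten_mapP[i _ /flatten_mapP[c _]]].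
  exact: (HT (i, c)).1.
have [le_st|] := boolP (s <= t)%MM; first by exists s; rewrite ?inE ?eqxx.
rewrite -[(_ <= _)%MM]/[forall i, s i <= t i]%N negb_forall => /existsP[i].
rewrite -ltnNge => lt_i.
have iA : i \in A.
  by apply: contraTT lt_i => niA; rewrite (eqS s t) // ltnn.
have [u uT le_ut] := (HT (i, t i)).2 iA t St erefl.
exists u => //; rewrite inE; apply/orP; right; apply/flatten_mapP.
exists i; first by rewrite mem_enum.
by apply/flatten_mapP; exists (t i); rewrite ?mem_iota.
Qed.

Lemma dickson n (S : 'X_{1..n} -> Prop) :
  exists T : seq 'X_{1..n}, (forall t, t \in T -> S t) /\
    forall s, S s -> exists2 t, t \in T & (t <= s)%MM.
Proof.
by apply: (@dickson_aux n _ finset.setT) => // s t i _ _; rewrite inE.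
Qed.

(** * Groebner division with control of the coefficients *)

Section Division.
Variables (F : fieldType) (n : nat).
Local Notation R := {mpoly F[n]}.

(** [P] need not be a subring: the condition has to make sense for the maximal ideal as well as for
    the local ring. *)
Definition stable_coefs (P : {pred F}) (g : R) :=
  forall a mon, a \in P -> a * g@_mon \in P.

Lemma mpolyOver_mul (P : zmodClosed F) (h g : R) :
  stable_coefs P g -> h \is a mpolyOver n P -> h * g \is a mpolyOver n P.
Proof.
move=> Pg /mpolyOverP Ph; apply/mpolyOverP=> mon; rewrite mcoeffM.
by apply: rpred_sum => ? _; apply: Pg.
Qed.

(** The generators are a Groebner basis with leading coefficients 1. Dividing by monic elements
    never inverts a coefficient, so each step only multiplies elements of [P] by coefficients of the
    basis. The basis does not depend on [P]. *)
Lemma ideal_division (I : R -> Prop) :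
  (forall a b, I a -> I b -> I (a - b)) -> (forall c a, I a -> I (c * a)) ->
  exists r (G : 'rV[R]_r), (forall i, I (G 0 i)) /\
    forall (P : zmodClosed F), (forall i, stable_coefs P (G 0 i)) ->
    forall y, I y -> y \is a mpolyOver n P ->
    exists t : 'cV[R]_r, (forall i, t i 0 \is a mpolyOver n P) /\
      y%:M = G *m t.
Proof.
move=> IB IM.
have [T [TI Tdom]] :=
  dickson (fun s => exists g : R, [/\ I g, mlead g = s & mleadc g = 1]).
have /choice[g gP] : forall s, exists g : R, s \in T ->
    [/\ I g, mlead g = s & mleadc g = 1].
  by move=> s; case: (boolP (s \in T)) => [/TI[g ?]|_]; [exists g | exists 0].
exists (size T), (\row_i g (tnth (in_tuple T) i)); split.
  by move=> i; rewrite mxE; case: (gP _ (mem_tnth i (in_tuple T))).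
move=> P stP; elim/mleadrect => y IH Iy Py.
have [y0|yN0] := eqVneq y 0.
  exists 0; split=> [i|]; first by rewrite mxE rpred0.
  by rewrite y0 mulmx0 raddf0.
have lN0 : mleadc y != 0 by rewrite mleadc_eq0.
(* Scaling [y] to a monic element of [I] shows that its leading exponent is in the set given to
   Dickson's lemma. *)
have [|s sT le_s] := Tdom (mlead y).
  exists ((mleadc y)^-1%:MP * y); split; first exact: IM.
    by rewrite mul_mpolyC mleadZ ?invr_eq0.
  by rewrite mul_mpolyC mleadcZE mulVf.
have [Ig lg lcg] := gP s sT.
have [j js] : exists j, s = tnth (in_tuple T) j by apply/tnthP.
(* The product [h * g s] has the leading term of [y], and the only coefficient of [h] is one of [y],
   hence in [P]. *)
pose h : R := mleadc y *: 'X_[mlead y - s].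
have Ph : h \is a mpolyOver n P.
  apply/mpolyOverP=> mon; rewrite mcoeffZ mcoeffX.
  by case: eqP => _; rewrite ?mulr1 ?mulr0 ?rpred0 //; apply: (mpolyOverP _ Py).
have gN0 : g s != 0 by rewrite -mleadc_eq0 lcg oner_eq0.
have lch : mleadc h = mleadc y.
  by rewrite mleadcZE mleadXm mcoeffX eqxx mulr1.
have leadM : mlead (h * g s) = (mlead h + mlead (g s))%MM.
  by rewrite mleadM // -mleadc_eq0 lch.
have leadh : mlead (h * g s) = mlead y.
  by rewrite leadM lg mleadZ // mleadXm submK.
have lchg : mleadc (h * g s) = mleadc y.
  by rewrite leadM mleadcM lcg lch mulr1.
have Py' : y - h * g s \is a mpolyOver n P.
  by rewrite rpredB // mpolyOver_mul // js; have := stP j; rewrite mxE.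
have [t [Pt yt]] : exists t : 'cV[R]_(size T),
    (forall i, t i 0 \is a mpolyOver n P) /\
    (y - h * g s)%:M = (\row_i g (tnth (in_tuple T) i)) *m t.
  (* The leading exponent of 0 is 0 by convention and need not be smaller than that of [y], so a
     zero remainder is treated apart. *)
  have [y'0|y'N0] := eqVneq (y - h * g s) 0.
    exists 0; split=> [i|]; first by rewrite mxE rpred0.
    by rewrite y'0 mulmx0 raddf0.
  apply: IH => //; last exact/IB/IM.
  (* If the leading exponent had not dropped, the leading coefficient of the remainder would be the
     difference of two equal ones. *)
  rewrite lt_neqAle; apply/andP; split.
    apply: contra_neq y'N0 => e; apply/eqP; rewrite -mleadc_eq0 e mcoeffB.
    by rewrite -[in X in _ - X]leadh lchg subrr.
  by apply: le_trans (mleadB_le _ _) _; rewrite leadh joinxx.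
exists (t + h *: delta_mx j 0); split=> [i|].
  rewrite !mxE rpredD //; case: (i == j); rewrite /= ?mulr1 ?mulr0 //.
  exact: rpred0.
rewrite mulmxDr -yt -scalemxAr -colE.
apply/matrixP=> a b; rewrite !mxE !ord1 eqxx -js !mulr1n.
by rewrite subrK.
Qed.

(** Induction on the rank: the first entries of the elements of [Q] form an ideal, and the elements
    with first entry 0 form a submodule of rank one less. A basis consists of lifts of a basis of
    the ideal together with a basis of that submodule. *)
Lemma submodule_division p (Q : 'cV[R]_p -> Prop) :
  (forall a b, Q a -> Q b -> Q (a - b)) -> (forall c a, Q a -> Q (c *: a)) ->
  exists r (G : 'M[R]_(p, r)), (forall i, Q (col i G)) /\
    forall (P : zmodClosed F), (forall i j, stable_coefs P (G i j)) ->
    forall y, Q y -> (forall i, y i 0 \is a mpolyOver n P) ->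
    exists t : 'cV[R]_r, (forall i, t i 0 \is a mpolyOver n P) /\ y = G *m t.
Proof.
elim: p => [|p IH] in Q *.
  move=> QB QM; exists 0, 0; split=> [[]//|P _ y _ _].
  by exists 0; split=> [[]//|]; apply/matrixP=> -[].
rewrite -[p.+1]/(1 + p)%N in Q * => QB QM.
have [r1 [G1 [QG1 div1]]] : exists r (G : 'rV[R]_r),
    (forall i, exists z, Q (col_mx (G 0 i)%:M z)) /\
    forall (P : zmodClosed F), (forall i, stable_coefs P (G 0 i)) ->
    forall y, (exists z, Q (col_mx y%:M z)) -> y \is a mpolyOver n P ->
    exists t : 'cV[R]_r, (forall i, t i 0 \is a mpolyOver n P) /\
      y%:M = G *m t.
  apply: (ideal_division (I := fun a => exists z, Q (col_mx a%:M z))).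
    move=> a b [x Qx] [y Qy]; exists (x - y).
    by rewrite raddfB -add_col_mx -opp_col_mx; apply: QB.
  move=> c a [x Qx]; exists (c *: x).
  by rewrite -scale_scalar_mx -scale_col_mx; apply: QM.
have /choice[z1 Qz1] := QG1.
have Q0 a : Q a -> Q 0 by move=> Qa; rewrite -(subrr a); apply: QB.
have QD a b : Q a -> Q b -> Q (a + b).
  move=> Qa Qb; rewrite -[b]opprK; apply: (QB) => //; rewrite -sub0r.
  exact: QB (Q0 a Qa) Qb.
have [||r2 [G2 [QG2 div2]]] := IH (fun z => Q (col_mx 0 z)).
- by move=> a b Qa Qb; rewrite -[0](subrr 0) -add_col_mx -opp_col_mx; apply: QB.
- by move=> c a Qa; rewrite -[0](scaler0 _ c) -scale_col_mx; apply: QM.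
(* The columns of [col_mx G1 Z] are the chosen lifts to [Q] of the ideal basis [G1]. *)
pose Z := \matrix_(i < p, j < r1) z1 j i 0.
have colZ j : col j Z = z1 j.
  by apply/matrixP=> a b; rewrite !mxE !ord1.
have colG1 j : col j (col_mx G1 Z) = col_mx (G1 0 j)%:M (z1 j).
  rewrite col_col_mx colZ; congr col_mx.
  by apply/matrixP=> a b; rewrite !mxE !ord1 eqxx mulr1n.
exists (r1 + r2)%N, (block_mx G1 0 Z G2); split=> [i|P stP y Qy Py].
  rewrite block_mxEh; case: (split_ordP i) => j ->.
    by rewrite colKl colG1; apply: Qz1.
  by rewrite colKr col_col_mx col0; apply: QG2.
have [|||t1 [Pt1 e1]] := div1 P _ (y (lshift p 0) 0).
- by move=> i; have := stP (lshift p 0) (lshift r2 i); rewrite block_mxEul.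
- exists (dsubmx y).
  suff -> : col_mx (y (lshift p 0) 0)%:M (dsubmx y) = y by [].
  rewrite -[RHS]vsubmxK; congr col_mx.
  by apply/matrixP=> a b; rewrite !mxE !ord1 eqxx mulr1n.
- exact: Py.
have uy : usubmx y = G1 *m t1.
  by rewrite -e1; apply/matrixP=> a b; rewrite !mxE !ord1 eqxx mulr1n.
(* Subtracting the lifts weighted by [t1] kills the first entry. The rest keeps its coefficients in
   [P] because the entries of [Z] are among those assumed stable. *)
have [|||t2 [Pt2 e2]] := div2 P _ (dsubmx y - Z *m t1).
- by move=> i j; have := stP (rshift 1 i) (rshift r1 j); rewrite block_mxEdr.
- have -> : col_mx 0 (dsubmx y - Z *m t1) = y - col_mx G1 Z *m t1.
    by rewrite -{2}[y]vsubmxK mul_col_mx opp_col_mx add_col_mx uy subrr.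
  apply: (QB) => //.
  have -> : col_mx G1 Z *m t1 = \sum_j t1 j 0 *: col j (col_mx G1 Z).
    apply/matrixP=> a b; rewrite mxE summxE; apply: eq_bigr => j _.
    by rewrite !mxE ord1 mulrC.
  apply: (big_ind Q) => [|a b|j _]; [exact: (Q0 y) | exact: QD |].
  by apply: QM; rewrite colG1.
- move=> i; rewrite !mxE rpredB ?Py // rpred_sum // => j _.
  rewrite mulrC mpolyOver_mul //.
  by have := stP (rshift 1 i) (lshift r2 j); rewrite block_mxEdl.
exists (col_mx t1 t2); split=> [i|].
  by case: (split_ordP i) => j ->; rewrite ?col_mxEu ?col_mxEd.
by rewrite mul_block_col mul0mx addr0 -e2 addrC subrK -uy vsubmxK.
Qed.

(* P will be the local ring at alpha or its maximal ideal. *)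
Definition bounded_division (gs : seq R) p q (A : 'M[R]_(p, q)) : Prop :=
  forall P : zmodClosed F, (forall g, g \in gs -> stable_coefs P g) ->
  forall z, (forall i, (A *m z) i 0 \is a mpolyOver n P) ->
  exists t : 'cV[R]_q, (forall i, t i 0 \is a mpolyOver n P) /\
    A *m z = A *m t.

(** Divide by a basis [G = A *m C] of the image of [A], then multiply the quotients by [C]; the list
    consists of the entries of [G] and of [C]. *)
Lemma bounded_division_exists p q (A : 'M[R]_(p, q)) :
  exists gs, bounded_division gs A.
Proof.
have [||r [G [AG div]]] :=
  submodule_division (Q := fun y => exists z, y = A *m z).
- by move=> _ _ [a ->] [b ->]; exists (a - b); rewrite mulmxBr.
- by move=> c _ [a ->]; exists (c *: a); rewrite scalemxAr.
have /choice[c cP] := AG.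
pose C := \matrix_(i < q, j < r) c j i 0.
have GC : G = A *m C.
  apply/matrixP=> i j; have /matrixP/(_ i 0) := cP j; rewrite !mxE => ->.
  by apply: eq_bigr => l _; rewrite mxE.
exists ([seq G i j | i <- enum 'I_p, j <- enum 'I_r] ++
        [seq C i j | i <- enum 'I_q, j <- enum 'I_r]) => P stP z Pz.
have [i j||t [Pt e]] := div P _ (A *m z) _ Pz; last 1 first.
- exists (C *m t); split=> [i|]; last by rewrite mulmxA -GC.
  rewrite mxE rpred_sum // => j _; rewrite mulrC mpolyOver_mul //.
  apply: stP; rewrite mem_cat; apply/orP; right.
  by apply: (allpairs_f (fun i j => C i j)); rewrite mem_enum.
- apply: stP; rewrite mem_cat; apply/orP; left.
  by apply: (allpairs_f (fun i j => G i j)); rewrite mem_enum.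
- by exists z.
Qed.

End Division.

(** * Specialization of polynomials whose coefficients are fractions *)

Section FractionSpecialization.
Variables (D : idomainType) (F G : fieldType).
Variables (f : {rmorphism D -> F}) (g : {rmorphism D -> G}) (n : nat).
Hypothesis f_inj : injective f.

(* For f = tofrac and g = eval_coef iota alpha this is convertible to
   specializes. *)
Definition frac_spec (a : {mpoly F[n]}) (b : {mpoly G[n]}) : Prop :=
  exists (p : {mpoly D[n]}) (q : D),
    [/\ g q != 0, a = (f q)^-1 *: map_mpoly f p
      & b = (g q)^-1 *: map_mpoly g p].
Local Notation sp := frac_spec.

Definition frac_specializable (a : {mpoly F[n]}) : Prop := exists b, sp a b.

Let f_neq0 q : g q != 0 -> f q != 0.
Proof.
apply: contra_neq => fq; have -> : q = 0 by apply: f_inj; rewrite fq rmorph0.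
exact: rmorph0.
Qed.

(** Stated for an arbitrary [h] so that it computes the difference both over [F] and over [G]. *)
Let num_denB (H : fieldType) (h : {rmorphism D -> H})
    (p p' : {mpoly D[n]}) q q' :
  h q != 0 -> h q' != 0 ->
  (h q)^-1 *: map_mpoly h p - (h q')^-1 *: map_mpoly h p' =
  (h (q * q'))^-1 *: map_mpoly h (q' *: p - q *: p').
Proof.
move=> hq hq'; rewrite [map_mpoly h (_ - _)]raddfB /= !map_mpolyZ rmorphM.
by rewrite scalerBr !scalerA invfM mulfVK // mulrAC mulVf // mul1r.
Qed.

Lemma frac_spec_fun a b1 b2 : sp a b1 -> sp a b2 -> b1 = b2.
Proof.
move=> [p1 [q1 [hq1 -> ->]]] [p2 [q2 [hq2 e ->]]].
exact: fraction_eval_unique f_inj hq1 hq2 e.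
Qed.

Lemma frac_specB a b a' b' : sp a b -> sp a' b' -> sp (a - a') (b - b').
Proof.
move=> [p [q [eq -> ->]]] [p' [q' [eq' -> ->]]].
exists (q' *: p - q *: p'), (q * q'); split.
- by rewrite rmorphM mulf_neq0.
- by apply: num_denB; apply: f_neq0.
- exact: num_denB.
Qed.

Lemma frac_specM a b a' b' : sp a b -> sp a' b' -> sp (a * a') (b * b').
Proof.
move=> [p [q [eq -> ->]]] [p' [q' [eq' -> ->]]].
exists (p * p'), (q * q'); split.
- by rewrite rmorphM mulf_neq0.
- by rewrite !rmorphM /= -scalerAl -scalerAr scalerA invfM.
- by rewrite !rmorphM /= -scalerAl -scalerAr scalerA invfM.
Qed.

Lemma frac_spec_map p : sp (map_mpoly f p) (map_mpoly g p).
Proof. by exists p, 1; split; rewrite rmorph1 ?oner_eq0 // invr1 scale1r. Qed.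

Lemma frac_spec0 : sp 0 0.
Proof.
exists 0, 1; split; first by rewrite rmorph1 oner_eq0.
  by rewrite [map_mpoly f 0]raddf0 scaler0.
by rewrite [map_mpoly g 0]raddf0 scaler0.
Qed.

Lemma frac_specD a b a' b' : sp a b -> sp a' b' -> sp (a + a') (b + b').
Proof.
move=> ab ab'; rewrite -[a']opprK -[b']opprK -[- a']sub0r -[- b']sub0r.
exact/(frac_specB ab)/(frac_specB frac_spec0).
Qed.

Lemma frac_spec_sum I (r : seq I) (a : I -> {mpoly F[n]}) b :
  (forall i, sp (a i) (b i)) -> sp (\sum_(i <- r) a i) (\sum_(i <- r) b i).
Proof.
by move=> ab; elim/big_ind2: _ => // *; [exact: frac_spec0 | exact: frac_specD].
Qed.

Lemma frac_specX mon : sp 'X_[mon] 'X_[mon].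
Proof. by have := frac_spec_map 'X_[mon]; rewrite !map_mpolyX. Qed.

Lemma frac_spec_mcoeff a b mon : sp a b -> sp (a@_mon)%:MP (b@_mon)%:MP.
Proof.
move=> [p [q [eq -> ->]]]; exists (p@_mon)%:MP, q; split=> //.
  by rewrite mcoeffZ mcoeff_map_mpoly map_mpolyC mpolyCM mul_mpolyC.
by rewrite mcoeffZ mcoeff_map_mpoly map_mpolyC mpolyCM mul_mpolyC.
Qed.

Lemma frac_spec_fracC p q : g q != 0 ->
  sp (f p / f q)%:MP (g p / g q)%:MP.
Proof.
move=> eq; exists p%:MP, q; split=> //; rewrite map_mpolyC.
  by rewrite -mul_mpolyC -mpolyCM mulrC.
by rewrite -mul_mpolyC -mpolyCM mulrC.
Qed.

(** The residue map from the local ring to [G] is onto; for evaluation at alpha this says that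
    k(alpha) consists of quotients of values of polynomials. *)
Hypothesis g_frac : forall c, exists p q, g q != 0 /\ c = g p / g q.

Lemma frac_spec_onto b : exists a, sp a b.
Proof.
have coefE mon : exists a, sp a (b@_mon *: 'X_[mon]).
  have [p [q [eq ->]]] := g_frac b@_mon.
  exists ((f p / f q)%:MP * 'X_[mon]); rewrite -mul_mpolyC.
  by apply: frac_specM; [exact: frac_spec_fracC | exact: frac_specX].
have [a abE] := choice coefE.
exists (\sum_(mon <- msupp b) a mon); rewrite [X in sp _ X]mpolyE.
exact: frac_spec_sum.
Qed.

(** * The local ring and its maximal ideal *)

Definition local_ring : {pred F} :=
  [pred c | `[< frac_specializable (c%:MP : {mpoly F[n]}) >]].
Definition maximal_ideal : {pred F} :=
  [pred c | `[< sp c%:MP 0 >]].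

Fact local_ring_zmod_closed : zmod_closed local_ring.
Proof.
split=> [|c d /asboolP[b cb] /asboolP[b' db]]; apply/asboolP.
  by exists 0; rewrite mpolyC0; apply: frac_spec0.
by exists (b - b'); rewrite raddfB; apply: frac_specB.
Qed.
HB.instance Definition _ :=
  GRing.isZmodClosed.Build _ local_ring local_ring_zmod_closed.

Fact maximal_ideal_zmod_closed : zmod_closed maximal_ideal.
Proof.
split=> [|c d /asboolP cb /asboolP db]; apply/asboolP.
  by rewrite mpolyC0; apply: frac_spec0.
by rewrite -[X in sp _ X](subrr 0) raddfB; apply: frac_specB.
Qed.
HB.instance Definition _ :=
  GRing.isZmodClosed.Build _ maximal_ideal maximal_ideal_zmod_closed.

Lemma local_ring_stable (a : {mpoly F[n]}) :
  frac_specializable a -> stable_coefs local_ring a.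
Proof.
move=> [b ab] c mon /asboolP[d cd]; apply/asboolP.
exists (d * (b@_mon)%:MP); rewrite mpolyCM.
exact/frac_specM/frac_spec_mcoeff.
Qed.

(** The coefficients of [a] lie in the local ring, and its maximal ideal absorbs them. *)
Lemma maximal_ideal_stable (a : {mpoly F[n]}) :
  frac_specializable a -> stable_coefs maximal_ideal a.
Proof.
move=> [b ab] c mon /asboolP cd; apply/asboolP.
by rewrite -(mul0r (b@_mon)%:MP) mpolyCM; apply/frac_specM/frac_spec_mcoeff.
Qed.

Lemma frac_specializableP a :
  frac_specializable a <-> a \is a mpolyOver n local_ring.
Proof.
split=> [[b ab]|/mpolyOverP Oa].
  apply/mpolyOverP=> mon; apply/asboolP; exists (b@_mon)%:MP.
  exact: frac_spec_mcoeff.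
have /choice[b ab] mon : exists b, sp (a@_mon)%:MP b by apply/asboolP/Oa.
rewrite [a]mpolyE; exists (\sum_(mon <- msupp a) b mon * 'X_[mon]).
apply: frac_spec_sum => mon; rewrite -mul_mpolyC.
by apply: frac_specM => //; apply: frac_specX.
Qed.

Lemma frac_spec0P a : sp a 0 <-> a \is a mpolyOver n maximal_ideal.
Proof.
split=> [a0|/mpolyOverP Oa].
  apply/mpolyOverP=> mon; apply/asboolP.
  by have := frac_spec_mcoeff mon a0; rewrite mcoeff0 mpolyC0.
have -> : 0 = \sum_(mon <- msupp a) 0 :> {mpoly G[n]} by rewrite big1.
rewrite [X in sp X _]mpolyE; apply: frac_spec_sum => mon.
rewrite -mul_mpolyC -(mul0r 'X_[mon]).
by apply: frac_specM; [exact/asboolP/Oa | exact: frac_specX].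
Qed.

(** * Specialization of matrices, of their kernels and of their images *)

Definition frac_spec_mx p q (A : 'M[{mpoly F[n]}]_(p, q))
    (B : 'M[{mpoly G[n]}]_(p, q)) : Prop :=
  forall i j, sp (A i j) (B i j).

Lemma frac_spec_mulmx p q r (A : 'M_(p, q)) (C : 'M_(q, r)) A' C' :
  frac_spec_mx A A' -> frac_spec_mx C C' ->
  frac_spec_mx (A *m C) (A' *m C').
Proof.
move=> hA hC i j; rewrite !mxE; apply: frac_spec_sum => l.
exact: frac_specM.
Qed.

Lemma frac_spec_mxB p q (A C : 'M_(p, q)) A' C' :
  frac_spec_mx A A' -> frac_spec_mx C C' ->
  frac_spec_mx (A - C) (A' - C').
Proof. by move=> hA hC i j; rewrite !mxE; apply: frac_specB. Qed.

Lemma frac_spec_mx_fun p q (A : 'M_(p, q)) B C :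
  frac_spec_mx A B -> frac_spec_mx A C -> B = C.
Proof.
by move=> hB hC; apply/matrixP=> i j; exact: frac_spec_fun (hB i j) (hC i j).
Qed.

Lemma frac_spec_mx_onto p q (B : 'M_(p, q)) : exists A, frac_spec_mx A B.
Proof.
have /choice[a ab] : forall ij, exists a, sp a (B ij.1 ij.2).
  by move=> ij; apply: frac_spec_onto.
by exists (\matrix_(i, j) a (i, j)) => i j; rewrite mxE; apply: (ab (i, j)).
Qed.

Lemma frac_spec_row_mx p q1 q2 (A : 'M_(p, q1)) (C : 'M_(p, q2)) A' C' :
  frac_spec_mx A A' -> frac_spec_mx C C' ->
  frac_spec_mx (row_mx A C) (row_mx A' C').
Proof.
by move=> hA hC i j; case: (split_ordP j) => l ->; rewrite ?row_mxEl ?row_mxEr.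
Qed.

Lemma frac_spec_col_mx p1 p2 q (A : 'M_(p1, q)) (C : 'M_(p2, q)) A' C' :
  frac_spec_mx A A' -> frac_spec_mx C C' ->
  frac_spec_mx (col_mx A C) (col_mx A' C').
Proof.
by move=> hA hC i j; case: (split_ordP i) => l ->; rewrite ?col_mxEu ?col_mxEd.
Qed.

(** A relation over [G] is lifted to [F], corrected to a genuine relation without changing its
    specialization, solved there by [ker], and the solution is moved into the local ring before
    specializing. *)
Lemma specialized_kernel p q1 q2 r gs (A1 : 'M_(p, q1)) (A2 : 'M_(p, q2))
    (C : 'M_(q1, r)) A1' A2' C' :
  bounded_division gs (row_mx A1 A2) -> bounded_division gs C ->
  (forall h, h \in gs -> frac_specializable h) ->
  frac_spec_mx A1 A1' -> frac_spec_mx A2 A2' -> frac_spec_mx C C' ->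
  (forall z y : 'cV_ _, A1 *m z = A2 *m y -> exists t, z = C *m t) ->
  forall z y : 'cV_ _, A1' *m z = A2' *m y -> exists t, z = C' *m t.
Proof.
move=> divA divC gsP s1 s2 sC ker z' y' e'.
have [z zz'] := frac_spec_mx_onto z'; have [y yy'] := frac_spec_mx_onto (- y').
have szy := frac_spec_col_mx zz' yy'.
have s0 := frac_spec_mulmx (frac_spec_row_mx s1 s2) szy.
rewrite [X in frac_spec_mx _ X]mul_row_col mulmxN e' subrr in s0.
(* The error of the lifted relation specializes to 0, so it is the image of some [t] with
   coefficients in the maximal ideal. Subtracting [t] makes the relation exact and leaves the
   specialization unchanged. *)
have [h hgs|i|t [t0 e]] := divA maximal_ideal _ (col_mx z y).
- exact/maximal_ideal_stable/gsP.
- by apply/frac_spec0P; have := s0 i 0; rewrite [X in sp _ X]mxE.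
have st : frac_spec_mx t 0 by move=> i j; rewrite mxE ord1; apply/frac_spec0P.
have sz : frac_spec_mx (z - usubmx t) z'.
  rewrite -[z']subr0; apply: frac_spec_mxB => // i j.
  rewrite [usubmx t i j]mxE; have := st (lshift q2 i) j.
  by rewrite [X in sp _ X]mxE [(0 : matrix _ _ _) i j]mxE.
have [s zs] : exists s, z - usubmx t = C *m s.
  apply: (ker _ (- (y - dsubmx t))); apply/eqP; rewrite -subr_eq0 mulmxN opprK.
  by rewrite -mul_row_col -add_col_mx -opp_col_mx vsubmxK mulmxBr e subrr.
(* The solution [s] may have poles at alpha; division replaces it by [w] over the local ring with
   the same image under [C]. *)
have [h hgs|i|w [Ow ew]] := divC local_ring _ s.
- exact/local_ring_stable/gsP.
- by apply/frac_specializableP; rewrite -zs; exists (z' i 0).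
have /choice[w' ww'] : forall i, exists b, sp (w i 0) b.
  by move=> i; apply/frac_specializableP.
exists (\col_i w' i); apply: (frac_spec_mx_fun sz); rewrite zs ew.
by apply: frac_spec_mulmx => // i j; rewrite mxE ord1.
Qed.

(** Only the solution has to be moved into the local ring here: any lift of [z'] already satisfies
    the hypothesis over [F]. *)
Lemma specialized_image p q r gs (A : 'M_(p, q)) (C : 'M_(p, r)) A' C' :
  bounded_division gs C -> (forall h, h \in gs -> frac_specializable h) ->
  frac_spec_mx A A' -> frac_spec_mx C C' ->
  (forall z : 'cV_q, exists t, A *m z = C *m t) ->
  forall z : 'cV_q, exists t, A' *m z = C' *m t.
Proof.
move=> divC gsP sA sC im z'.
have [z zz'] := frac_spec_mx_onto z'; have [t0 e0] := im z.
have sAz := frac_spec_mulmx sA zz'.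
have [h hgs|i|t [Ot e]] := divC local_ring _ t0.
- exact/local_ring_stable/gsP.
- by apply/frac_specializableP; rewrite -e0; exists ((A' *m z') i 0).
have /choice[t' tt'] : forall i, exists b, sp (t i 0) b.
  by move=> i; apply/frac_specializableP.
exists (\col_i t' i); apply: (frac_spec_mx_fun sAz); rewrite e0 e.
by apply: frac_spec_mulmx => // i j; rewrite mxE ord1.
Qed.

End FractionSpecialization.

(** * Elements of fraction fields as quotients *)

Lemma fractionP (D : idomainType) (c : {fraction D}) :
  exists p q, q != 0 /\ c = tofrac p / tofrac q.
Proof.
elim/quotW: c => x; exists (frac x).1, (frac x).2.
split; first exact: denom_ratioP.
apply: (canRL (mulfK _)); first by rewrite tofrac_eq0 denom_ratioP.
unlock tofrac; rewrite -[LHS]FracField.pi_mul /FracField.mulf.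
apply/eqmodP; rewrite /= FracField.equivfE.
by rewrite !numden_Ratio ?(oner_neq0, mulf_neq0, mulr1, denom_ratioP) // mulrC.
Qed.

Lemma fractions_divring_closed (D : idomainType) (G : fieldType)
    (g : {rmorphism D -> G}) :
  divring_closed [pred z | `[< exists p q, g q != 0 /\ z = g p / g q >]].
Proof.
split=> [|_ _ /asboolP[p [q [hq ->]]] /asboolP[p' [q' [hq' ->]]]
         |_ _ /asboolP[p [q [hq ->]]] /asboolP[p' [q' [hq' ->]]]];
  apply/asboolP.
- by exists 1, 1; rewrite rmorph1 divr1 oner_eq0.
- exists (p * q' - p' * q), (q * q'); rewrite rmorphM mulf_neq0 //; split=> //.
  by rewrite -[in LHS]mulNr addf_div // mulNr rmorphB !rmorphM.
(* Division by 0 gives 0 by convention, so the zero divisor needs its own representation 0/1. *)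
- have [z|nz] := eqVneq (g p') 0.
    by exists 0, 1; rewrite z mul0r invr0 mulr0 rmorph0 rmorph1 mul0r oner_eq0.
  exists (p * q'), (q * p'); rewrite !rmorphM mulf_neq0 //; split=> //.
  by rewrite invf_div mulf_div.
Qed.

(** * Nonvanishing of polynomials over an infinite field *)

Lemma poly_nonroot (F : fieldType) (p : {poly F}) :
  infinite_set [set: F] -> p != 0 -> exists c, p.[c] != 0.
Proof.
move=> infF pN0; apply: contrapT => nex.
have [B _ leB] := infinite_set_fset (size p) infF.
have: (size p < size p)%N; last by rewrite ltnn.
apply: leq_ltn_trans leB _; apply: max_poly_roots => //.
  2: exact: finmap.fset_uniq.
apply/allP => c _; apply/rootP/eqP; apply: contrapT => /negP h.
by apply: nex; exists c.
Qed.

Lemma mpoly_nonroot (F : fieldType) m (p : {mpoly F[m]}) :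
  infinite_set [set: F] -> p != 0 -> exists v, p.@[v] != 0.
Proof.
move=> infF; elim: m => [|m IH] in p *.
  move=> pN0; have pC : p = (p@_0%MM)%:MP.
    apply/mpolyP=> a; have -> : a = 0%MM by apply/mnmP=> -[].
    by rewrite mcoeffC eqxx mulr1.
  exists (fun=> 0); apply: contra_neq pN0.
  by rewrite pC mevalC => ->; apply: mpolyC0.
move=> pN0.
(* The last variable is split off: [slice j] is the coefficient of its j-th power, a polynomial in
   the other variables. *)
pose res (a : 'X_{1..m.+1}) := [multinom a (fintype.lift ord_max i) | i < m].
pose slice j := \sum_(a <- msupp p | a ord_max == j) p@_a *: 'X_[res a].
have res_inj (a b : 'X_{1..m.+1}) :
    a ord_max = b ord_max -> res a = res b -> a = b.
  move=> e /mnmP eab; apply/mnmP=> i; case: (unliftP ord_max i) => [j ->|-> //].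
  by have := eab j; rewrite !mnmE.
pose a0 := mlead p.
(* The coefficient of this slice at [res a0] is the leading coefficient of [p], since no other
   monomial of [p] has the same last exponent and the same restriction. *)
have sN0 : slice (a0 ord_max) != 0.
  apply: contra_neq pN0 => s0; apply/eqP; rewrite -mleadc_eq0.
  have := congr1 (mcoeff (res a0)) s0; rewrite mcoeff0 raddf_sum /=.
  have [a0p|] := boolP (a0 \in msupp p); last by rewrite -mcoeff_eq0.
  rewrite big_mkcond (bigD1_seq a0) ?msupp_uniq //= eqxx mcoeffZ mcoeffX eqxx.
  rewrite mulr1 big1 => [|a ne]; first by rewrite addr0 => ->.
  case: ifP => // /eqP aj; rewrite mcoeffZ mcoeffX.
  case: eqP => [e|_]; last by rewrite mulr0.
  by case/eqP: ne; apply: res_inj.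
have [v vN0] := IH _ sN0.
(* This is [p] with all variables but the last evaluated at [v]; its coefficients are the values of
   the slices at [v]. *)
pose q : {poly F} :=
  \sum_(a <- msupp p) (p@_a * \prod_i v i ^+ res a i) *: 'X^(a ord_max).
have [|c cN0] := @poly_nonroot _ q infF.
  apply: contra_neq vN0 => q0.
  suff <- : q`_(a0 ord_max) = (slice (a0 ord_max)).@[v] by rewrite q0 coef0.
  rewrite coef_sum raddf_sum /= [RHS]big_mkcond; apply: eq_bigr => a _.
  rewrite coefZ coefXn eq_sym; case: eqP; rewrite ?mulr0 // mulr1.
  by rewrite mevalZ mevalX.
pose vc i := if unlift ord_max i is Some j then v j else c.
exists vc; suff -> : p.@[vc] = q.[c] by [].
rewrite horner_sum mevalE; apply: eq_bigr => a _.
rewrite hornerZ hornerXn -mulrA; congr (_ * _).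
rewrite (bigD1_ord ord_max) //= {1}/vc unlift_none mulrC; congr (_ * _).
by apply: eq_bigr => i _; rewrite /vc liftK mnmE.
Qed.

(** * Properties that hold for almost all alpha *)

Section Generic.
Variables (k K : fieldType) (iota : {rmorphism k -> K}) (m n : nat).
Local Notation ev alpha := (eval_coef iota alpha).

(** Links evaluation in k(alpha), used for specialization, with evaluation over K, used for zero
    loci. *)
Lemma val_eval_coef alpha (q : {mpoly k[m]}) :
  val (ev alpha q) = (map_mpoly iota q).@[alpha].
Proof.
rewrite {2}[q]mpolyE [map_mpoly _ _]raddf_sum [RHS]raddf_sum.
rewrite /eval_coef /mmap raddf_sum; apply: eq_bigr => a _.
transitivity (val (adjoin_const iota alpha q@_a) *
              val (mmap1 (adjoin_gen iota alpha) a)); first exact: rmorphM.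
rewrite rmorph_prod /= map_mpolyZ map_mpolyX mevalZ mevalX.
by congr (_ * _); apply: eq_bigr => i _;
  exact: (rmorphXn (\val : adjoin iota alpha -> K)).
Qed.

(** The quotients of values at alpha form a subfield containing k and the coordinates of alpha,
    hence contain k(alpha), the smallest such subfield. *)
Lemma adjoin_fraction (alpha : 'I_m -> K) (c : adjoin iota alpha) :
  exists p q, ev alpha q != 0 /\ c = ev alpha p / ev alpha q.
Proof.
pose h : {rmorphism {mpoly k[m]} -> K} := val \o ev alpha.
have /asboolP[p [q [qN0 e]]] :
    val c \in [pred z | `[< exists p q, h q != 0 /\ z = h p / h q >]].
  have /in_adjoinP := valP c; apply=> [|d|i].
  - exact: fractions_divring_closed.
  - apply/asboolP; exists d%:MP, 1; rewrite rmorph1 divr1 oner_eq0; split=> //.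
    by rewrite /= /eval_coef mmapC.
  - apply/asboolP; exists 'X_i, 1; rewrite rmorph1 divr1 oner_eq0; split=> //.
    by rewrite /= /eval_coef mmapX mmap1U.
exists p, q; split; first by apply: contra_neq qN0 => /= ->.
apply: val_inj; rewrite e.
exact/esym/(fmorph_div (\val : adjoin iota alpha -> K)).
Qed.

(** With a single polynomial as witness, finite conjunctions are obtained by multiplying
    witnesses. *)
Definition generically (P : ('I_m -> K) -> Prop) : Prop :=
  exists2 q : {mpoly k[m]}, q != 0 & forall alpha, ev alpha q != 0 -> P alpha.

Lemma generically_and P Q :
  generically P -> generically Q ->
  generically (fun alpha => P alpha /\ Q alpha).
Proof.
move=> [q qN0 hP] [r rN0 hQ].
exists (q * r) => [|alpha]; first exact: mulf_neq0.
by rewrite rmorphM mulf_eq0 negb_or => /andP[/hP ? /hQ ?].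
Qed.

Lemma generically_all (T : eqType) (s : seq T) (P : T -> ('I_m -> K) -> Prop) :
  (forall x, generically (P x)) ->
  generically (fun alpha => forall x, x \in s -> P x alpha).
Proof.
move=> hP; elim: s => [|x s IH]; first by exists 1; rewrite ?oner_eq0.
have [q qN0 hq] := generically_and (hP x) IH; exists q => // alpha /hq[Px Ps] y.
by rewrite inE => /predU1P[->|/Ps].
Qed.

(** As k is infinite, [q] is nonzero at some point of k^m, whose image in K^m lies outside the zero
    locus of [q]. *)
Lemma generically_almost_all P :
  infinite_set [set: k] -> generically P -> almost_all P.
Proof.
move=> infk [q qN0 hP]; exists [set map_mpoly iota q]; split.
  have [v vN0] := mpoly_nonroot infk qN0 => e.
  have : zero_locus [set map_mpoly iota q] (iota \o v) by rewrite e.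
  move=> /(_ _ erefl); apply/eqP; apply: contra_neq vN0 => h.
  apply: (fmorph_inj iota); rewrite rmorph0 -h {2}[q]mpolyE.
  rewrite [map_mpoly _ _]raddf_sum [RHS]raddf_sum mevalE.
  rewrite [LHS]rmorph_sum.
  apply: eq_bigr => a _ /=.
  rewrite map_mpolyZ map_mpolyX mevalZ mevalX rmorphM rmorph_prod.
  by congr (_ * _); apply: eq_bigr => i _; rewrite rmorphXn.
move=> alpha nz; apply: hP; apply/eqP => e0; apply: nz => _ ->.
by rewrite -val_eval_coef e0 rmorph0.
Qed.

Lemma tofrac_inj (D : idomainType) : injective (@tofrac D).
Proof. by move=> x y /eqP; rewrite tofrac_eq => /eqP. Qed.

(** It suffices that alpha avoids the zeros of the denominators of the finitely many coefficients of
    [a]. *)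
Lemma generically_specializable (a : genpoly k m n) :
  generically (fun alpha => specializable iota alpha a).
Proof.
rewrite [a]mpolyE; elim/big_ind: _ => [|b c hb hc|mon _].
- exists 1 => [|alpha _]; first exact: oner_neq0.
  by exists 0; apply: (frac_spec0 _ (eval_coef iota alpha)).
- have [q qN0 hq] := generically_and hb hc.
  exists q => // alpha /hq[[b' bb'] [c' cc']].
  exists (b' + c').
  by apply: (frac_specD (g := eval_coef iota alpha) (@tofrac_inj _) bb' cc').
- have [p [q [qN0 ->]]] := fractionP a@_mon; exists q => // alpha qa.
  exists ((ev alpha p / ev alpha q)%:MP * 'X_[mon]); rewrite -mul_mpolyC.
  apply: (frac_specM (frac_spec_fracC _ _ _ qa)); exact: frac_specX.
Qed.

Lemma generically_specializable_mx p q (A : 'M[genpoly k m n]_(p, q)) :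
  generically (fun alpha => specializable_mx iota alpha A).
Proof.
have [r rN0 hr] := generically_all [seq (i, j) | i <- enum 'I_p, j <- enum 'I_q]
  (fun ij => generically_specializable (A ij.1 ij.2)).
exists r => // alpha /hr h i j; apply: (h (i, j)).
by apply/allpairsP; exists (i, j); rewrite !mem_enum.
Qed.

Lemma specialize_specializes alpha (a : genpoly k m n) :
  specializable iota alpha a ->
  specializes a (specialize iota alpha a).
Proof. by move=> [b ab]; apply: (xgetPex 0); exists b. Qed.

Lemma spec_mxP alpha p q (A : 'M[genpoly k m n]_(p, q)) :
  specializable_mx iota alpha A ->
  frac_spec_mx (@tofrac _) (ev alpha) A (spec_mx iota alpha A).
Proof. by move=> hA i j; rewrite mxE; apply: specialize_specializes. Qed.

End Generic.

(** * Exactness of the specialized sequence *)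

Lemma frac_spec_mx1 (D : idomainType) (F G : fieldType)
    (f : {rmorphism D -> F}) (g : {rmorphism D -> G}) n p :
  frac_spec_mx f g (1%:M : 'M[{mpoly F[n]}]_p) (1%:M : 'M[{mpoly G[n]}]_p).
Proof.
move=> i j; rewrite !mxE.
have := frac_spec_map f g ((i == j)%:R : {mpoly D[n]}).
by rewrite !rmorph_nat.
Qed.

(** Both products are specializations of the same matrix, and specializations are unique. *)
Lemma spec_lift_comm (k K : fieldType) (iota : {rmorphism k -> K}) m n
    (alpha : 'I_m -> K) (L M : lmodType (genpoly k m n))
    (PL : presentation L) (PM : presentation M) (v : {linear L -> M})
    (V : pres_lift PL PM v) :
  specializable_mx iota alpha (pres_mx PL) ->
  specializable_mx iota alpha (pres_mx PM) ->
  specializable_mx iota alpha (lift0 V) ->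
  specializable_mx iota alpha (lift1 V) -> spec_map_defined iota alpha V.
Proof.
move=> hL hM h0 h1; split=> //.
apply: (frac_spec_mx_fun (@tofrac_inj _) (A := lift0 V *m pres_mx PL)).
  by apply: (frac_spec_mulmx (@tofrac_inj _)); apply: spec_mxP.
rewrite lift1_comm.
by apply: (frac_spec_mulmx (@tofrac_inj _)); apply: spec_mxP.
Qed.

Lemma spec_mapE (k K : fieldType) (iota : {rmorphism k -> K}) m n
    (alpha : 'I_m -> K) (L M : lmodType (genpoly k m n))
    (PL : presentation L) (PM : presentation M) (v : {linear L -> M})
    (V : pres_lift PL PM v) (d : spec_map_defined iota alpha V) z :
  spec_map d (to_coker _ z) = to_coker _ (spec_mx iota alpha (lift0 V) *m z).
Proof. exact: coker_mapE. Qed.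

Lemma to_coker_eq0 (S : comNzRingType) p q (A : 'M[S]_(p, q)) z :
  to_coker A z = 0 <-> exists t, z = A *m t.
Proof. by rewrite -(raddf0 (to_coker A)) to_coker_eq subr0. Qed.

Theorem theorem2p4 (k : fieldType) (k_infinite : infinite_set [set: k])
    (K : fieldType) (iota : {rmorphism k -> K}) (m n : nat)
    (L M N : lmodType (genpoly k m n))
    (PL : presentation L) (PM : presentation M) (PN : presentation N)
    (v : {linear L -> M}) (w : {linear M -> N})
    (V : pres_lift PL PM v) (W : pres_lift PM PN w) :
  short_exact v w ->
  almost_all (fun alpha : 'I_m -> K =>
    exists (dv : spec_map_defined iota alpha V)
           (dw : spec_map_defined iota alpha W),
      short_exact (spec_map dv) (spec_map dw)).
Proof.
move=> [v_inj vw_exact w_surj].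
have kerM y : pres_proj PM (pres_mx PM *m y) = 0 by apply/pres_exact; exists y.
have kerN y : pres_proj PN (pres_mx PN *m y) = 0 by apply/pres_exact; exists y.
(* Exactness is first translated into four statements on column vectors: injectivity of [v], kernel
   of [w] inside the image of [v], [w] after [v] zero, surjectivity of [w]. *)
have exactL (z y : 'cV_ _) : lift0 V *m z = pres_mx PM *m y ->
    exists t, z = pres_mx PL *m t.
  move=> e; have /pres_exact[t <-] : pres_proj PL z = 0; last by exists t.
  by apply: v_inj; rewrite (lift0_comm V) e kerM.
have exactM (z y : 'cV_ _) : lift0 W *m z = pres_mx PN *m y ->
    exists t, z = row_mx (lift0 V) (pres_mx PM) *m t.
  move=> e; have /vw_exact[x vx] : w (pres_proj PM z) = 0.
    by rewrite (lift0_comm W) e kerN.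
  have [s xs] := pres_surj PL x.
  have /pres_exact[r er] : pres_proj PM (z - lift0 V *m s) = 0.
    by rewrite raddfB /= -(lift0_comm V) xs vx subrr.
  by exists (col_mx s r); rewrite mul_row_col er addrC subrK.
have complexN (z : 'cV_ _) :
    exists t, lift0 W *m lift0 V *m z = pres_mx PN *m t.
  have /pres_exact[t et] : pres_proj PN (lift0 W *m lift0 V *m z) = 0.
    rewrite -mulmxA -(lift0_comm W) -(lift0_comm V).
    by apply/vw_exact; exists (pres_proj PL z).
  by exists t.
(* The factor [1%:M] turns surjectivity into an inclusion of images, as [specialized_image]
   requires. *)
have ontoN (z : 'cV_ _) :
    exists t, 1%:M *m z = row_mx (lift0 W) (pres_mx PN) *m t.
  have [y wy] := w_surj (pres_proj PN z); have [s ys] := pres_surj PM y.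
  have /pres_exact[r er] : pres_proj PN (z - lift0 W *m s) = 0.
    by rewrite raddfB /= -(lift0_comm W) ys wy subrr.
  by exists (col_mx s r); rewrite mul1mx mul_row_col er addrC subrK.
have [g1 div1] := bounded_division_exists (row_mx (lift0 V) (pres_mx PM)).
have [g2 div2] := bounded_division_exists (row_mx (lift0 W) (pres_mx PN)).
have [g3 div3] := bounded_division_exists (pres_mx PL).
have [g4 div4] := bounded_division_exists (pres_mx PN).
(* A longer list admits fewer [P], so one common list serves all four matrices. *)
have sub_div gs gs' p q (A : 'M[genpoly k m n]_(p, q)) :
    {subset gs <= gs'} -> bounded_division gs A -> bounded_division gs' A.
  by move=> sgs dA P stP; apply: dA => g /sgs/stP.
pose gs := g1 ++ g2 ++ g3 ++ g4.
have {}div1 : bounded_division gs (row_mx (lift0 V) (pres_mx PM)).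
  by apply: sub_div div1 => g; rewrite !mem_cat => ->.
have {}div2 : bounded_division gs (row_mx (lift0 W) (pres_mx PN)).
  by apply: sub_div div2 => g; rewrite !mem_cat => ->; rewrite orbT.
have {}div3 : bounded_division gs (pres_mx PL).
  by apply: sub_div div3 => g; rewrite !mem_cat => ->; rewrite !orbT.
have {}div4 : bounded_division gs (pres_mx PN).
  by apply: sub_div div4 => g; rewrite !mem_cat => ->; rewrite !orbT.
apply: (generically_almost_all (iota := iota)) => //.
have gmx p q (A : 'M[genpoly k m n]_(p, q)) :=
  generically_specializable_mx iota A.
have [q qN0 hq] := generically_and
  (generically_all gs (generically_specializable iota (m := m) (n := n)))
  (generically_and (gmx _ _ (pres_mx PL))
  (generically_and (gmx _ _ (pres_mx PM))
  (generically_and (gmx _ _ (pres_mx PN)) (generically_and (gmx _ _ (lift0 V))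
  (generically_and (gmx _ _ (lift1 V)) (generically_and (gmx _ _ (lift0 W))
  (gmx _ _ (lift1 W)))))))).
exists q => // alpha /hq[gsP [hL [hM [hN [hV0 [hV1 [hW0 hW1]]]]]]].
have dv := spec_lift_comm hL hM hV0 hV1.
have dw := spec_lift_comm hM hN hW0 hW1.
exists dv, dw.
have frac := @adjoin_fraction k K iota m alpha.
have [sL sM sN] := And3 (spec_mxP hL) (spec_mxP hM) (spec_mxP hN).
have [sV sW] := conj (spec_mxP hV0) (spec_mxP hW0).
have f_inj := @tofrac_inj {mpoly k[m]}.
split=> [x|y|z].
- rewrite -[x]coker_reprK spec_mapE => /to_coker_eq0[t].
  move=> /(specialized_kernel f_inj frac div1 div3 gsP sV sM sL exactL).
  by move/to_coker_eq0.
- rewrite -[y]coker_reprK; split.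
    rewrite spec_mapE => /to_coker_eq0[t].
    have sVM := frac_spec_row_mx sV sM.
    have ker := specialized_kernel f_inj frac div2 div1 gsP sW sN sVM exactM.
    move=> /ker[s ->].
    (* The lower block of [s] contributes a combination of relations of M, which vanishes in the
       cokernel. *)
    exists (to_coker _ (usubmx s)); rewrite spec_mapE; apply/to_coker_eq.
    exists (- dsubmx s); rewrite -{2}[s]vsubmxK mul_row_col mulmxN.
    by rewrite opprD addrA subrr sub0r.
  move=> [x <-]; rewrite -[x]coker_reprK !spec_mapE; apply/to_coker_eq0.
  have sWV := frac_spec_mulmx f_inj sW sV.
  rewrite mulmxA.
  exact: (specialized_image f_inj frac div4 gsP sWV sN complexN).
- rewrite -[z]coker_reprK.
  have sWN := frac_spec_row_mx sW sN.
  have s1 := @frac_spec_mx1 _ _ _ (@tofrac _) (eval_coef iota alpha) n.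
  have [t] := specialized_image f_inj frac div2 gsP (s1 _) sWN ontoN
    (coker_repr z).
  rewrite mul1mx => ->; exists (to_coker _ (usubmx t)); rewrite spec_mapE.
  apply/to_coker_eq; exists (- dsubmx t).
  rewrite -{2}[t]vsubmxK mul_row_col mulmxN.
  by rewrite opprD addrA subrr sub0r.
Qed.
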